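(* Let $M\in\mathbb{R}^{n\times n}$, where $n=2\nu$ is even. Then $M\in NQS_n$ if and only if $$M=\mathcal{X}_n\begin{pmatrix}Y&V^T\\ W&Z\end{pmatrix}\mathcal{X}_n$$ for some $Y\in B_\nu\cap S_\nu$, $Z\in B_\nu\cap N_\nu$, and $V,W\in A_\nu$ with the properties $$V1_\nu=W1_\nu=0_\nu,\qquad V^T\sigma_\nu=W^T\sigma_\nu=0_\nu.$$
   Context: $1_m$, $0_m$ are the all-ones and null column vectors in $\mathbb{R}^m$, $\sigma_m\in\mathbb{R}^m$ is the column vector with $j$th entry $(-1)^{j-1}$; $X^\bot=\{u\in\mathbb{R}^m\mid u^Tv=0\ (v\in X)\}$ for $X\subset\mathbb{R}^m$. $\mathcal{I}_\nu$ is the $\nu\times\nu$ unit matrix, $\mathcal{J}_\nu=(\delta_{i,\nu+1-j})_{i,j=1}^\nu$, and for $n=2\nu$, $\mathcal{X}_n=\frac1{\sqrt2}\begin{pmatrix}\mathcal{I}_\nu&\mathcal{J}_\nu\\ \mathcal{J}_\nu&-\mathcal{I}_\nu\end{pmatrix}$. $NQS_n=N_n\cap Q_n\cap S_n$ for even $n$. The spaces of matrices $M\in\mathbb{R}^{m\times m}$ are, with indices in $\mathbb{Z}_m=\mathbb{Z}/m\mathbb{Z}$ (modulo $m$): $S_m$: there is $w\in\mathbb{R}$ with $\sum_jM_{i,j}=\sum_jM_{j,i}=mw$ for all $i$. $A_m$: $M_{i,j}+M_{m+1-i,m+1-j}=0$ for all $i,j$. $B_m$: $M_{i,j}-M_{m+1-i,m+1-j}=0$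 for all $i,j$. $Q_m$ ($m=2\mu$ even): $M_{i,j}-M_{i+\mu,j+\mu}=0$ for all $i,j$. $N_m$ ($m$ even): $\sum_{i\in\mathbb{Z}_m}(-1)^i(M_{i,j}+M_{i,j+1})=\sum_{i\in\mathbb{Z}_m}(-1)^i(M_{j,i}+M_{j+1,i})=0$ for all $j\in\mathbb{Z}_m$. $N_m$ ($m$ odd): $\sigma_m^TMu=0=u^TM\sigma_m$ for all $u\in\{\sigma_m\}^\bot$. *)

(* Defs.v *)
From mathcomp Require Import all_boot all_order all_algebra.
From mathcomp Require Import boolp classical_sets reals.

Set Implicit Arguments.
Unset Strict Implicit.
Unset Printing Implicit Defensive.

Import GRing.Theory Num.Theory.

Local Open Scope ring_scope.
Local Open Scope classical_set_scope.

(* Rows and columns are numbered 0, ..., m - 1 instead of 1, ..., m, so the   *)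
(* reflection i |-> m + 1 - i is [rev_ord] and the cyclic successor           *)
(* j |-> j + 1 of Z/mZ is [ordS].                                             *)

Definition ones {R : realType} (m : nat) : 'cV[R]_m := const_mx 1.

(* The j-th entry, counted from 1, is (-1)^(j - 1). *)
Definition sigma {R : realType} (m : nat) : 'cV[R]_m := \col_j (-1) ^+ j.

Definition orth {R : realType} m (X : set 'cV[R]_m) : set 'cV[R]_m :=
  [set u | forall v, X v -> u^T *m v = 0].

Definition spaceS {R : realType} {m : nat} : set 'M[R]_m :=
  [set M | exists w : R, forall i,
     \sum_j M i j = m%:R * w /\ \sum_j M j i = m%:R * w].

Definition spaceA {R : realType} {m : nat} : set 'M[R]_m :=
  [set M | forall i j, M i j + M (rev_ord i) (rev_ord j) = 0].

Definition spaceB {R : realType} {m : nat} : set 'M[R]_m :=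
  [set M | forall i j, M i j - M (rev_ord i) (rev_ord j) = 0].

(* i |-> i + k in Z/mZ *)
Definition cshift (m k : nat) (i : 'I_m) : 'I_m := iter k (@ordS m) i.

Definition spaceQ {R : realType} {mu : nat} : set 'M[R]_(mu + mu) :=
  [set M | forall i j, M i j - M (cshift mu i) (cshift mu j) = 0].

(* For even m the sign (-1)^i is well defined on Z/mZ; numbering from 0       *)
(* changes it by a global factor -1, which is irrelevant here.                *)
Definition spaceN {R : realType} {m : nat} : set 'M[R]_m :=
  [set M |
    if odd m then
      forall u, orth [set sigma m] u ->
        (sigma m)^T *m M *m u = 0 /\ u^T *m M *m sigma m = 0
    else
      forall j,
        \sum_(i < m) (-1) ^+ i * (M i j + M i (ordS j)) = 0 /\
        \sum_(i < m) (-1) ^+ i * (M j i + M (ordS j) i) = 0].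

Definition spaceNQS {R : realType} {nu : nat} : set 'M[R]_(nu + nu) :=
  spaceN `&` spaceQ `&` spaceS.

Definition exchange_mx {R : realType} (nu : nat) : 'M[R]_nu :=
  \matrix_(i, j) (i == rev_ord j)%:R.

Definition blockX {R : realType} (nu : nat) : 'M[R]_(nu + nu) :=
  (Num.sqrt 2)^-1 *:
    block_mx 1%:M (exchange_mx nu) (exchange_mx nu) (- 1%:M).

(* Main.v *)
Require Import Defs.
From mathcomp Require Import all_boot all_order all_algebra.
From mathcomp Require Import boolp classical_sets reals.

Import Order.TTheory GRing.Theory Num.Theory.

Local Open Scope ring_scope.
Local Open Scope classical_set_scope.

(** X is a symmetric involution, so M = X K X is the same as K = X M X, and each
    of the three conditions on M can be read off the blocks of K.  S says that
    ones is an eigenvector of M and of M^T, and N says the same of sigma.  Up to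
    nonzero scalars, X maps ones to (ones, 0) and sigma to (0, sigma).  Q says
    that M commutes with the block swap T, and X T X = diag(J, -J), so it says
    that Y and Z commute and V and W anticommute with the exchange matrix J. *)

(** The eigenvalue is left free and [v = 0] is allowed; for [ones m] and [sigma m] that happens only
    when [m = 0]. *)
Definition is_eigenvector {R : realType} {m : nat} (M : 'M[R]_m) (v : 'cV[R]_m) :=
  exists c : R, M *m v = c *: v.

(** The permutation matrix of the shift by half the period in Z/2mZ. *)
Definition swap_mx {R : realType} (m : nat) : 'M[R]_(m + m) :=
  block_mx 0 1%:M 1%:M 0.

(** * The exchange matrix and the spaces A and B as commutation relations *)

Lemma exchange_mxE (R : realType) m (i j : 'I_m) :
  @exchange_mx R m i j = (i == rev_ord j)%:R.
Proof. by rewrite mxE. Qed.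

Lemma mul_exchange_mx (R : realType) m p (M : 'M[R]_(m, p)) i j :
  (exchange_mx m *m M) i j = M (rev_ord i) j.
Proof.
rewrite mxE (bigD1 (rev_ord i)) //= exchange_mxE rev_ordK eqxx mul1r.
rewrite big1 ?addr0 // => k ki; rewrite exchange_mxE.
by rewrite -(inj_eq rev_ord_inj) rev_ordK eq_sym (negPf ki) mul0r.
Qed.

Lemma mul_mx_exchange (R : realType) m p (M : 'M[R]_(p, m)) i j :
  (M *m exchange_mx m) i j = M i (rev_ord j).
Proof.
rewrite mxE (bigD1 (rev_ord j)) //= exchange_mxE eqxx mulr1.
by rewrite big1 ?addr0 // => k kj; rewrite exchange_mxE (negPf kj) mulr0.
Qed.

Lemma exchange_mx_sqr (R : realType) m :
  exchange_mx m *m exchange_mx m = 1%:M :> 'M[R]_m.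
Proof.
apply/matrixP => i j; rewrite mul_mx_exchange exchange_mxE rev_ordK.
by rewrite mxE.
Qed.

Lemma tr_exchange_mx (R : realType) m :
  (exchange_mx m)^T = exchange_mx m :> 'M[R]_m.
Proof.
apply/matrixP => i j; rewrite mxE !exchange_mxE.
by rewrite -(inj_eq rev_ord_inj) rev_ordK eq_sym.
Qed.

Lemma exchange_ones (R : realType) m : exchange_mx m *m ones m = ones m :> 'cV[R]_m.
Proof. by apply/matrixP => i j; rewrite mul_exchange_mx !mxE. Qed.

(** Reversal turns the exponent [i] into [m - 1 - i], which has the parity of [m + i + 1]. *)
Lemma exchange_sigma (R : realType) m :
  exchange_mx m *m sigma m = - (-1) ^+ m *: sigma m :> 'cV[R]_m.
Proof.
apply/matrixP => i j; rewrite mul_exchange_mx !mxE /=.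
rewrite -signr_odd oddB // signr_addb !signr_odd exprS mulN1r.
by rewrite mulrN mulNr.
Qed.

Lemma spaceBP (R : realType) m (M : 'M[R]_m) :
  spaceB M <-> M *m exchange_mx m = exchange_mx m *m M.
Proof.
split=> [MB | MJ i j].
  apply/matrixP => i j; rewrite mul_mx_exchange mul_exchange_mx.
  by have /eqP := MB i (rev_ord j); rewrite subr_eq0 rev_ordK => /eqP.
apply/eqP; rewrite subr_eq0 -(mul_exchange_mx R m m M) -MJ.
by rewrite mul_mx_exchange rev_ordK.
Qed.

Lemma spaceAP (R : realType) m (M : 'M[R]_m) :
  spaceA M <-> M *m exchange_mx m = - (exchange_mx m *m M).
Proof.
split=> [MA | MJ i j].
  apply/matrixP => i j; rewrite mul_mx_exchange [RHS]mxE mul_exchange_mx.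
  by have /eqP := MA i (rev_ord j); rewrite addr_eq0 rev_ordK => /eqP.
have /matrixP/(_ i (rev_ord j)) := MJ; rewrite mul_mx_exchange rev_ordK => ->.
by rewrite [X in X + _]mxE mul_exchange_mx addNr.
Qed.

Lemma spaceA_tr (R : realType) m (M : 'M[R]_m) : spaceA M^T <-> spaceA M.
Proof. by split=> MA i j; have := MA j i; rewrite !mxE. Qed.

(** * The half-period shift and the space Q *)

Lemma cshiftE m k (i : 'I_m) : cshift k i = ((i + k) %% m)%N :> nat.
Proof.
rewrite /cshift; elim: k => [|k IHk] /=; first by rewrite addn0 modn_small.
by rewrite IHk -addn1 modnDml addn1 addnS.
Qed.

Lemma cshift_lshift m (i : 'I_m) : cshift m (lshift m i) = rshift m i.
Proof.
apply/val_inj => /=; rewrite cshiftE /= addnC modn_small //.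
by rewrite ltn_add2l.
Qed.

Lemma cshift_rshift m (i : 'I_m) : cshift m (rshift m i) = lshift m i.
Proof.
apply/val_inj => /=; rewrite cshiftE /= addnAC modnDl modn_small //.
by rewrite ltn_addr.
Qed.

(** The shift by [m] interchanges the two halves of the indices, so both sides say that the diagonal
    blocks agree and the off-diagonal blocks agree. *)
Lemma spaceQP (R : realType) m (M : 'M[R]_(m + m)) :
  spaceQ M <-> M *m swap_mx m = swap_mx m *m M.
Proof.
rewrite -[M]submxK /swap_mx !mulmx_block !(mulmx0, mul0mx, mulmx1, mul1mx).
rewrite !(add0r, addr0).
set a := ulsubmx M; set b := ursubmx M; set c := dlsubmx M; set d := drsubmx M.
split=> [MQ | /eq_block_mx [bc ad _ _] i j].
  have bc : b = c.
    apply/matrixP => i j; have := MQ (lshift m i) (rshift m j).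
    rewrite cshift_lshift cshift_rshift block_mxEur block_mxEdl.
    by move/eqP; rewrite subr_eq0 => /eqP.
  have ad : a = d.
    apply/matrixP => i j; have := MQ (lshift m i) (lshift m j).
    rewrite !cshift_lshift block_mxEul block_mxEdr.
    by move/eqP; rewrite subr_eq0 => /eqP.
  by rewrite bc ad.
apply/eqP; rewrite subr_eq0 -bc ad; apply/eqP.
case: (split_ordP i) => i' ->; case: (split_ordP j) => j' ->;
by rewrite ?cshift_lshift ?cshift_rshift ?block_mxEul ?block_mxEur
           ?block_mxEdl ?block_mxEdr.
Qed.

(** * Row and column sums and the space S *)

Lemma mulmx_onesE (R : realType) m (M : 'M[R]_m) i j :
  (M *m ones m) i j = \sum_k M i k.
Proof. by rewrite mxE; apply: eq_bigr => k _; rewrite mxE mulr1. Qed.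

Lemma spaceSP (R : realType) m (M : 'M[R]_m) :
  spaceS M <-> is_eigenvector M (ones m) /\ is_eigenvector M^T (ones m).
Proof.
split=> [[w Mw] | [[c Mc] [d Md]]].
  split; exists (m%:R * w); apply/matrixP => i j; rewrite mulmx_onesE !mxE mulr1;
    have [Mr Mc] := Mw i => //.
  by rewrite -Mc; apply: eq_bigr => k _; rewrite mxE.
(* The size 0 is split off because the common weight is obtained by dividing by the size. *)
case: m => [|m] in M Mc Md *; first by exists 0 => -[].
have m0 : m.+1%:R != 0 :> R by rewrite pnatr_eq0.
(* Both eigenvalues are computed by the sum of all the entries of M. *)
have dc : d = c.
  have rowM i : \sum_j M i j = c.
    by rewrite -(mulmx_onesE R _ M i 0) Mc !mxE mulr1.
  have colM j : \sum_i M i j = d.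
    transitivity ((M^T *m ones m.+1) j 0); last by rewrite Md !mxE mulr1.
    by rewrite mulmx_onesE; apply: eq_bigr => i _; rewrite mxE.
  have : \sum_(i < m.+1) c = \sum_(j < m.+1) d.
    rewrite -(eq_bigr _ (fun i _ => rowM i)) -(eq_bigr _ (fun j _ => colM j)).
    exact: exchange_big.
  rewrite !sumr_const card_ord -(mulr_natl c) -(mulr_natl d).
  by move/(mulfI m0).
exists (c / m.+1%:R) => i; rewrite mulrCA mulfV // mulr1; split.
  by rewrite -(mulmx_onesE R _ M i 0) Mc !mxE mulr1.
have <- : (M^T *m ones m.+1) i 0 = c by rewrite Md !mxE mulr1 dc.
by rewrite mulmx_onesE; apply: eq_bigr => j _; rewrite mxE.
Qed.

(** * The alternating vector and the space N *)

Lemma sigma_ordS (R : realType) m (j : 'I_m) :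
  ~~ odd m -> (-1) ^+ ordS j = - (-1) ^+ j :> R.
Proof.
move=> m_even /=; rewrite -signr_odd odd_mod //; last exact: negPf.
by rewrite signr_odd exprS mulN1r.
Qed.

(** Unifies the two parities in the definition of N. For odd [m], [r] lies in the double orthogonal
    complement of [sigma m], which is its span; for even [m], the entries of [r] alternate in sign
    around the cycle. *)
Lemma multiple_of_sigmaP (R : realType) m (r : 'cV[R]_m) :
  (if odd m then forall u, orth [set sigma m] u -> r^T *m u = 0
   else forall j, r j 0 + r (ordS j) 0 = 0)
  <-> exists c, r = c *: sigma m.
Proof.
case: m r => [|m] r.
  by split=> _; [exists 0; rewrite [LHS]flatmx0 [RHS]flatmx0 | case].
split=> [|[c ->]].
  (* As [sigma] starts with 1, the factor can only be the first entry of [r]. *)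
  suff : (if odd m.+1 then forall u, orth [set sigma m.+1] u -> r^T *m u = 0
          else forall j, r j 0 + r (ordS j) 0 = 0) ->
         forall j, r j 0 = r 0 0 * (-1) ^+ j.
    move=> rE /rE {}rE; exists (r 0 0); apply/matrixP => i j.
    by rewrite ord1 rE !mxE.
  case: ifP => [_ rorth j | _ ralt [j ltjm]].
    (* This vector is orthogonal to [sigma], and pairing it with [r] compares the entries of [r] at
       [j] and 0. *)
    pose u : 'cV[R]_m.+1 := delta_mx j 0 - (-1) ^+ j *: delta_mx 0 0.
    have uorth : orth [set sigma m.+1] u.
      move=> _ ->; rewrite /u linearB linearZ /= !trmx_delta mulmxBl -scalemxAl.
      rewrite -!rowE; apply/matrixP => a b; rewrite !mxE /= expr0 mulr1.
      by rewrite subrr.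
    have := rorth u uorth.
    rewrite /u mulmxBr -scalemxAr -!colE => /matrixP/(_ 0 0).
    by rewrite !mxE => /eqP; rewrite subr_eq0 mulrC => /eqP.
  elim: j ltjm => [|j IHj] ltjm /=.
    by rewrite expr0 mulr1; congr (r _ _); apply: val_inj.
  have := ralt (Ordinal (ltnW ltjm)); rewrite IHj => /eqP.
  rewrite addrC addr_eq0 exprS mulN1r mulrN => /eqP <-.
  (* The cyclic successor does not wrap around here, since [j.+1 < m.+1]. *)
  by congr (r _ _); apply: val_inj; rewrite /= modn_small.
case: ifP => [_ u uorth | m_even j].
  apply: trmx_inj; rewrite trmx_mul trmxK -scalemxAr uorth //.
  by rewrite scaler0 trmx0.
by rewrite !mxE sigma_ordS ?m_even // mulrN subrr.
Qed.

(** Apply [multiple_of_sigmaP] to the two vectors [M *m sigma m] and [M^T *m sigma m]. *)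
Lemma spaceNP (R : realType) m (M : 'M[R]_m) :
  spaceN M <-> is_eigenvector M (sigma m) /\ is_eigenvector M^T (sigma m).
Proof.
have entry (N : 'M[R]_m) j :
    \sum_(i < m) (-1) ^+ i * (N i j + N i (ordS j)) =
    (N^T *m sigma m) j 0 + (N^T *m sigma m) (ordS j) 0.
  rewrite !mxE -big_split; apply: eq_bigr => i _.
  by rewrite !mxE mulrDr !(mulrC ((-1) ^+ i)).
rewrite /is_eigenvector -2!multiple_of_sigmaP /spaceN /=.
case: ifP => _; split.
- move=> MN; split=> u /MN[MNl MNr]; last by rewrite trmx_mul trmxK.
  by apply: trmx_inj; rewrite trmx_mul trmxK mulmxA MNr trmx0.
- move=> [MNr MNl] u uorth; split;
    first by have := MNl u uorth; rewrite trmx_mul trmxK.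
  by apply: trmx_inj; rewrite -mulmxA trmx_mul trmxK MNr ?trmx0.
- move=> MN; split=> j; have [MNl MNr] := MN j; last by rewrite -entry.
  (* Writing [M] as a double transpose lets [entry] apply to [M^T]. *)
  rewrite -{1 2}[M]trmxK -entry -[RHS]MNr.
  by apply: eq_bigr => i _; rewrite !mxE.
- move=> [MNr MNl] j; split; first by rewrite entry.
  rewrite -[RHS](MNr j) -{3 4}[M]trmxK -entry.
  by apply: eq_bigr => i _; rewrite !mxE.
Qed.

(** * The involution X and its action on the swap, [ones] and [sigma] *)

Lemma tr_blockX (R : realType) m : (blockX m)^T = blockX m :> 'M[R]_(m + m).
Proof.
by rewrite /blockX linearZ /= tr_block_mx !tr_exchange_mx linearN /= trmx1.
Qed.

Lemma invr_sqrt2_sqr (R : realType) : (Num.sqrt 2)^-1 * (Num.sqrt 2)^-1 = 2^-1 :> R.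
Proof. by rewrite -invfM -expr2 sqr_sqrtr. Qed.

Lemma half_double (R : realType) p q (N : 'M[R]_(p, q)) : 2^-1 *: (N + N) = N.
Proof. by rewrite -mulr2n -scaler_nat scalerA mulVf ?scale1r ?pnatr_eq0. Qed.

Lemma blockX_sqr (R : realType) m : blockX m *m blockX m = 1%:M :> 'M[R]_(m + m).
Proof.
rewrite /blockX -scalemxAl -scalemxAr scalerA invr_sqrt2_sqr mulmx_block.
rewrite !(mulmxN, mulNmx, mulmx1, mul1mx) opprK exchange_mx_sqr !subrr.
by rewrite scale_block_mx !half_double !scaler0 -scalar_mx_block.
Qed.

Lemma blockX_swap (R : realType) m :
  blockX m *m swap_mx m *m blockX m =
  block_mx (exchange_mx m) 0 0 (- exchange_mx m) :> 'M[R]_(m + m).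
Proof.
rewrite /blockX /swap_mx -!scalemxAl -scalemxAr scalerA invr_sqrt2_sqr.
rewrite !mulmx_block !(mulmxN, mulNmx, mulmx1, mul1mx, mulmx0, mul0mx).
rewrite !(add0r, addr0) !exchange_mx_sqr subrr addNr !mulNmx !mul1mx -opprD.
by rewrite scale_block_mx scalerN !half_double !scaler0.
Qed.

(** Since [J] fixes [ones], the upper halves add up and the lower halves cancel. *)
Lemma blockX_ones (R : realType) m :
  exists2 a : R, a != 0 & blockX m *m ones (m + m) = a *: col_mx (ones m) 0.
Proof.
exists ((Num.sqrt 2)^-1 * 2).
  by rewrite mulf_neq0 ?invr_neq0 ?pnatr_eq0 // gt_eqF ?sqrtr_gt0.
have -> : ones (m + m) = col_mx (ones m) (ones m) :> 'cV[R]_(m + m).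
  by rewrite /ones col_mx_const.
rewrite /blockX -scalemxAl mul_block_col exchange_ones mulNmx !mul1mx subrr.
by rewrite -scalerA scaler_nat (mulr2n (col_mx _ _)) add_col_mx addr0.
Qed.

(** The lower half of [sigma] is [(-1) ^+ m *: sigma m], and [J] multiplies [sigma m] by the
    opposite sign: the upper part cancels and the lower part doubles. *)
Lemma blockX_sigma (R : realType) m :
  exists2 a : R, a != 0 & blockX m *m sigma (m + m) = a *: col_mx 0 (sigma m).
Proof.
exists ((Num.sqrt 2)^-1 * (- (-1) ^+ m * 2)).
  rewrite !mulf_neq0 ?invr_neq0 ?pnatr_eq0 ?oppr_eq0 ?signr_eq0 //.
  by rewrite gt_eqF ?sqrtr_gt0.
have -> : sigma (m + m) = col_mx (sigma m) ((-1) ^+ m *: sigma m)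
          :> 'cV[R]_(m + m).
  apply/matrixP => i j; rewrite mxE; case: (split_ordP i) => k ->.
    by rewrite col_mxEu mxE.
  by rewrite col_mxEd !mxE /= exprD.
rewrite /blockX -scalemxAl mul_block_col -scalemxAr exchange_sigma mulNmx !mul1mx.
rewrite scalerA mulrN -expr2 sqrr_sign scaleN1r subrr -!scalerA.
rewrite scaler_nat (mulr2n (col_mx _ _)) add_col_mx addr0 !scale_col_mx !scaler0.
by rewrite !scalerDr !scaleNr.
Qed.

(** * Eigenvectors and commutation under scaling, conjugation and block decomposition *)

Lemma is_eigenvector_scale (R : realType) m (M : 'M[R]_m) v a :
  a != 0 -> is_eigenvector M (a *: v) <-> is_eigenvector M v.
Proof.
move=> a0; split=> -[c Mv]; exists c; last by rewrite -scalemxAr Mv !scalerA mulrC.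
by apply: (scalerI a0); rewrite scalemxAr Mv !scalerA mulrC.
Qed.

Lemma is_eigenvector_conj (R : realType) m (X M : 'M[R]_m) v :
  X *m X = 1%:M -> is_eigenvector (X *m M *m X) v <-> is_eigenvector M (X *m v).
Proof.
move=> XX; split=> -[c Mv]; exists c.
  by rewrite scalemxAr -Mv !mulmxA XX mul1mx.
by rewrite -!mulmxA Mv -scalemxAr mulmxA XX mul1mx.
Qed.

Lemma is_eigenvector_block_u (R : realType) m (A B C D : 'M[R]_m) v :
  is_eigenvector (block_mx A B C D) (col_mx v 0) <-> is_eigenvector A v /\ C *m v = 0.
Proof.
rewrite /is_eigenvector mul_block_col !mulmx0 !addr0.
split=> [[c]|[[c Av] Cv]].
  by rewrite scale_col_mx scaler0 => /eq_col_mx[Av Cv]; split=> //; exists c.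
by exists c; rewrite scale_col_mx scaler0 Av Cv.
Qed.

Lemma is_eigenvector_block_d (R : realType) m (A B C D : 'M[R]_m) v :
  is_eigenvector (block_mx A B C D) (col_mx 0 v) <-> is_eigenvector D v /\ B *m v = 0.
Proof.
rewrite /is_eigenvector mul_block_col !mulmx0 !add0r.
split=> [[c]|[[c Dv] Bv]].
  by rewrite scale_col_mx scaler0 => /eq_col_mx[Bv Dv]; split=> //; exists c.
by exists c; rewrite scale_col_mx scaler0 Dv Bv.
Qed.

(** Conjugating the whole equation by the involution [X] moves the conjugation from [M] to [T]. *)
Lemma commute_conj (R : realType) m (X M T : 'M[R]_m) :
  X *m X = 1%:M ->
  (X *m M *m X) *m T = T *m (X *m M *m X) <->
  M *m (X *m T *m X) = (X *m T *m X) *m M.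
Proof.
move=> XX.
have XXK (N : 'M[R]_m) : N *m X *m X = N by rewrite -mulmxA XX mulmx1.
by split=> /(congr1 (fun N => X *m N *m X)); rewrite !mulmxA !XX !mul1mx !XXK.
Qed.

(** * Reading S, N and Q off the blocks *)

Section BlockX.
Variables (R : realType) (nu : nat) (Y V W Z : 'M[R]_nu).

Let K := block_mx Y V^T W Z.
Let M := blockX nu *m K *m blockX nu.

(** Transposition interchanges the roles of [V] and [W], so each condition on [M^T] gives for [V]
    what the one on [M] gives for [W], or conversely. *)
Let trM : M^T = blockX nu *m block_mx Y^T W^T V Z^T *m blockX nu.
Proof. by rewrite /M !trmx_mul tr_blockX tr_block_mx trmxK mulmxA. Qed.

Lemma spaceS_conj_blockX :
  spaceS M <-> spaceS Y /\ (V *m ones nu = 0 /\ W *m ones nu = 0).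
Proof.
have [a a0 Xa] := blockX_ones R nu.
rewrite !spaceSP trM !is_eigenvector_conj ?blockX_sqr // Xa.
by rewrite !is_eigenvector_scale // !is_eigenvector_block_u; tauto.
Qed.

Lemma spaceN_conj_blockX :
  spaceN M <-> spaceN Z /\ (V^T *m sigma nu = 0 /\ W^T *m sigma nu = 0).
Proof.
have [a a0 Xa] := blockX_sigma R nu.
rewrite !spaceNP trM !is_eigenvector_conj ?blockX_sqr // Xa.
by rewrite !is_eigenvector_scale // !is_eigenvector_block_d; tauto.
Qed.

Lemma spaceQ_conj_blockX :
  spaceQ M <-> (spaceB Y /\ spaceB Z) /\ (spaceA V /\ spaceA W).
Proof.
rewrite spaceQP commute_conj ?blockX_sqr // blockX_swap.
(* The block of [K] is [V^T], so the condition on [V] is first moved to its transpose. *)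
rewrite -(spaceA_tr _ _ V) !spaceAP !spaceBP /K !mulmx_block.
rewrite !(mulmx0, mul0mx, add0r, addr0, mulmxN, mulNmx).
split=> [/eq_block_mx[-> VJ -> /oppr_inj ->] | [[-> ->] [-> ->]]].
  by rewrite -VJ opprK.
by rewrite opprK.
Qed.

End BlockX.

Theorem theorem15 (R : realType) (nu : nat) (M : 'M[R]_(nu + nu)) :
  spaceNQS M <->
  exists Y Z V W : 'M[R]_nu,
    [/\ (spaceB `&` spaceS) Y,
        (spaceB `&` spaceN) Z,
        spaceA V /\ spaceA W,
        [/\ V *m ones nu = 0, W *m ones nu = 0,
            V^T *m sigma nu = 0 & W^T *m sigma nu = 0]
      & M = blockX nu *m block_mx Y V^T W Z *m blockX nu].
Proof.
split; last first.
  move=> [Y [Z [V [W [[YB YS] [ZB ZN] VWA [V1 W1 Vs Ws] ->]]]]].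
  by split; [split|]; [apply/spaceN_conj_blockX | apply/spaceQ_conj_blockX
                      | apply/spaceS_conj_blockX].
(* The blocks of [K] are the witnesses; the upper right one is transposed twice to match the form
   [V^T]. *)
pose K := blockX nu *m M *m blockX nu.
have -> : M = blockX nu *m block_mx (ulsubmx K) (ursubmx K)^T^T (dlsubmx K) (drsubmx K)
              *m blockX nu.
  by rewrite trmxK submxK /K !mulmxA blockX_sqr mul1mx -mulmxA blockX_sqr mulmx1.
move=> [[/spaceN_conj_blockX[ZN [Vs Ws]] /spaceQ_conj_blockX[[YB ZB] VWA]]
        /spaceS_conj_blockX[YS [V1 W1]]].
by exists (ulsubmx K), (drsubmx K), (ursubmx K)^T, (dlsubmx K).
Qed.
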